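(* Suppose $p_1,\ldots,p_n$ are conditionally valid (A1) and mutually independent (A2). Let $\theta\in\mathbb{R}^n$ be the true parameter vector, and let $$\mathcal T=\big(\{i\in[n]:\theta_i\le 0\}\cap\mathcal S^-\big)\cup\big(\{i\in[n]:\theta_i\ge 0\}\cap\mathcal S^+\big)$$ be the (random) set of indices of the true null hypotheses among the $n$ selected one-sided hypotheses. Then the local test of $H_{\mathcal T}$ satisfies conditional type I error control given the vector of signs: $$\sup_{\theta'\in H_{\mathcal T}}\mathbb{P}_{\theta'}\big(\phi_{\mathcal T}=1\mid\mathcal S\big)\le\alpha .$$ (That is, for every sign vector $s\in\{-1,1\}^n$, with $\mathcal S^-$, $\mathcal S^+$, $\mathcal T$, $H_{\mathcal T}$ being the fixed sets determined by $s$ and $\theta$, one has $\mathbb{P}_{\theta'}(\phi_{\mathcal T}=1\mid\mathcal S=s)\le\alpha$ for every $\theta'\in H_{\mathcal T}$ with $\mathbb{P}_{\theta'}(\mathcal S=s)>0$.)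
   Context: Setting. $[n]=\{1,\ldots,n\}$, $\alpha\in(0,1)$. $\{\mathbb{P}_\theta:\theta\in\mathbb{R}^n\}$ is a family of probability laws for a random vector $(p_1,\ldots,p_n)\in[0,1]^n$; $q_i=1-p_i$. Here $p_i$ is the $p$-value for $H_i^-:\theta_i\le 0$ and $q_i$ the $p$-value for $H_i^+:\theta_i\ge 0$ (test statistics are continuous). (A1) Conditional validity: for every $i$ and $x\in[0,1]$, $\mathbb{P}_\theta(2p_i\le x\mid p_i\le 1/2)\le x$ for all $\theta$ with $\theta_i\le 0$, and $\mathbb{P}_\theta(2q_i\le x\mid p_i>1/2)\le x$ for all $\theta$ with $\theta_i\ge 0$ (whenever the conditioning event has positive probability). (A2) Under every $\mathbb{P}_\theta$, $p_1,\ldots,p_n$ are mutually independent. Selection. $\mathcal S^-=\{i:p_i\le 1/2\}$, $\mathcal S^+=\{i:p_i>1/2\}$; for $i\in\mathcal S^-$ the hypothesis $H_i^-$ is selected for testing, for $i\in\mathcal S^+$ the hypothesis $H_i^+$ is selected. The vector of signs $\mathcal S\in\{-1,1\}^n$ has $i$th coordinate $-1$ if $p_i\le 1/2$ and $+1$ if $p_i>1/2$. Intersection hypotheses. For $\mathcal I\subseteq[n]$, $H_{\mathcal I}=\{\theta'\in\mathbb{R}^n:\theta'_i\le 0\ \forall i\in\mathcal I\cap\mathcal S^-,\ \theta'_j\ge 0\ \forall j\in\mathcal I\cap\mathcal S^+\}$. Combining function. $f$ is a family of measurable functions $f:[0,1]^d\to[0,1]$, $d\ge 1$, which is valid for independent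 $p$-values: if $x_1,\ldots,x_d$ are independent with $\mathbb{P}(x_i\le t)\le t$ for all $t\in[0,1]$, then $\mathbb{P}(f(x_1,\ldots,x_d)\le t)\le t$ for all $t\in[0,1]$. Convention: $f(\emptyset)=1$. Local test. $\phi_{\mathcal I}=\mathbf 1\{f(\{2p_i,i\in\mathcal I\cap\mathcal S^-\}\cup\{2q_j,j\in\mathcal I\cap\mathcal S^+\})\le\alpha\}$, where the collection of $|\mathcal I|$ values is listed in increasing order of index; thus $\phi_\emptyset=0$. *)

(* Defs.v *)
From HB Require Import structures.
From mathcomp Require Import all_boot all_order all_algebra.
From mathcomp Require Import all_classical all_reals all_analysis.
Set Implicit Arguments.
Unset Strict Implicit.
Unset Printing Implicit Defensive.
Import Order.TTheory GRing.Theory Num.Theory.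
Import numFieldNormedType.Exports.
Local Open Scope classical_set_scope.
Local Open Scope ring_scope.

Section probability.
Context {d : measure_display} {T : measurableType d} {R : realType}.
Implicit Type P : probability T R.

(* Every use below assumes 0 < P B. *)
Definition cond_prob P (A B : set T) : \bar R := (P (A `&` B) / P B)%E.

Definition mutually_independent P (I : finType) (X : I -> {mfun T >-> R}) :=
  forall (J : {set I}) (A : I -> set R),
    (forall i, i \in J -> measurable (A i)) ->
    P [set w | forall i, i \in J -> A i (X i w)] =
    (\prod_(i in J) P (X i @^-1` A i))%E.

End probability.

Section combining_function.
Context {R : realType}.
Variable f : forall m : nat, m.-tuple R -> R.

Definition unit_cube (m : nat) : set (m.-tuple R) :=
  [set x | forall i, tnth x i \in `[0, 1]%R].

(* f acts on [0,1]^m: its values outside the cube are irrelevant. *)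
Definition measurable_combining :=
  forall m : nat, (0 < m)%N ->
    measurable_fun (@unit_cube m) (@f m) /\
    (forall x : m.-tuple R, unit_cube x -> f x \in `[0, 1]%R).

Definition valid_for_independent :=
  forall m : nat, (0 < m)%N ->
  forall (d : measure_display) (T : measurableType d) (P : probability T R)
         (x : 'I_m -> {mfun T >-> R}),
    (forall i w, x i w \in `[0, 1]%R) ->
    mutually_independent P x ->
    (forall i (t : R), 0 <= t <= 1 ->
       (P [set w | (x i w <= t)%R] <= t%:E)%E) ->
    forall t : R, 0 <= t <= 1 ->
      (P [set w | (f [tuple x i w | i < m] <= t)%R] <= t%:E)%E.

Definition combining_function :=
  [/\ measurable_combining, valid_for_independent & f [tuple] = 1].

End combining_function.

Section selection.
Context {d : measure_display} {T : measurableType d} {R : realType} {n : nat}.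
Variable p : 'I_n -> {mfun T >-> R}.

Definition qval (i : 'I_n) (w : T) : R := 1 - p i w.

Definition signs (w : T) : {ffun 'I_n -> int} :=
  [ffun i => if p i w <= 2^-1 then -1 else 1].

Definition conditionally_valid (P : 'rV[R]_n -> probability T R) :=
  forall (i : 'I_n) (x : R) (theta : 'rV[R]_n), 0 <= x <= 1 ->
    (theta 0 i <= 0 ->
     (0 < P theta [set w | (p i w <= 2^-1)%R])%E ->
     (cond_prob (P theta) [set w | (2 * p i w <= x)%R]
                          [set w | (p i w <= 2^-1)%R] <= x%:E)%E) /\
    (0 <= theta 0 i ->
     (0 < P theta [set w | (2^-1 < p i w)%R])%E ->
     (cond_prob (P theta) [set w | (2 * qval i w <= x)%R]
                          [set w | (2^-1 < p i w)%R] <= x%:E)%E).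

Implicit Types (s : {ffun 'I_n -> int}) (I : {set 'I_n}).

Definition Sminus s : {set 'I_n} := [set i | s i == -1]%SET.
Definition Splus s : {set 'I_n} := [set i | s i == 1]%SET.

Definition true_nulls (theta : 'rV[R]_n) s : {set 'I_n} :=
  ([set i | theta 0 i <= 0%R] :&: Sminus s) :|:
  ([set i | 0%R <= theta 0 i] :&: Splus s).

Definition intersection_hypothesis I s : set 'rV[R]_n :=
  [set theta | (forall i, i \in I :&: Sminus s -> theta 0 i <= 0) /\
               (forall j, j \in I :&: Splus s -> 0 <= theta 0 j)].

Definition cond_pval (w : T) (i : 'I_n) : R :=
  if i \in Sminus (signs w) then 2 * p i w else 2 * qval i w.

(* enum_val lists the elements of I in increasing order. *)
Definition local_test (f : forall m : nat, m.-tuple R -> R) (alpha : R) I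
    (w : T) : bool :=
  f _ [tuple cond_pval w (enum_val k) | k < #|I|] <= alpha.

End selection.

(* Main.v *)
(* The event that the signs equal s is an intersection over i of events on p_i
   alone. Conditioning on it therefore keeps p_1, ..., p_n independent and
   conditions each p_i only on its own sign, so that by (A1) the conditional
   p-values of the true nulls are valid under the conditional law, and the
   combining function may be applied to them there. Both kinds of conditional
   p-value equal min(2p, 2q), which stays in [0, 1] off the conditioning event
   too, as validity of the combining function requires. *)

Require Import Defs.
From HB Require Import structures.
From mathcomp Require Import all_boot all_order all_algebra.
From mathcomp Require Import all_classical all_reals all_analysis.
From mathcomp Require Import measurable_realfun lra.
Import Order.TTheory GRing.Theory Num.Theory.
Import numFieldNormedType.Exports.
Local Open Scope classical_set_scope.
Local Open Scope ring_scope.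

(** Validity of the combining function is quantified over probability measures, so conditioning must
    yield such a measure before [f] can be applied under it. *)
Lemma cond_prob_probability {d : measure_display} {T : measurableType d}
    {R : realType} (P : probability T R) (B : set T) :
  measurable B -> (0 < P B)%E ->
  exists Q : probability T R, forall A, Q A = cond_prob P A B.
Proof.
(* The second argument [P] is the fallback of [mnormalize] for zero or infinite mass; [PB] and
   [PBfin] exclude both cases. *)
move=> mB PB; exists (mnormalize (mrestr P mB) P) => A.
have PBfin : P B \is a fin_num by exact: fin_num_measure.
rewrite /= /mnormalize /= /mrestr setTI gt_eqF //= lt_eqF ?ltey_eq ?PBfin //=.
rewrite /cond_prob -[in RHS](fineK PBfin) inver gt_eqF//.
by rewrite fine_gt0// PB ltey_eq PBfin.
Qed.

(** The conditioning event is a product event, so numerator and denominator of the conditional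
    probability both factor over all of [I]. The quotient is taken factor by factor, and the factors
    outside [J] cancel. *)
Lemma mutually_independent_cond {d : measure_display} {T : measurableType d}
    {R : realType} (P Q : probability T R) (I : finType)
    (X : I -> {mfun T >-> R}) (B : I -> set R) :
  (forall i, measurable (B i)) -> mutually_independent P X ->
  (0 < P [set w | forall i, B i (X i w)])%E ->
  (forall A, Q A = cond_prob P A [set w | forall i, B i (X i w)]) ->
  mutually_independent Q X /\
  forall i A, measurable A ->
    (0 < P (X i @^-1` B i))%E /\
    Q (X i @^-1` A) = cond_prob P (X i @^-1` A) (X i @^-1` B i).
Proof.
move=> mB indP PB0 QE.
pose b i := fine (P (X i @^-1` B i)).
have mX i A : measurable A -> measurable (X i @^-1` A).
  by move=> mA; rewrite -[_ @^-1` _]setTI; exact: measurable_funP.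
have Pfin i A : measurable A -> P (X i @^-1` A) = (fine (P (X i @^-1` A)))%:E.
  by move=> mA; rewrite fineK// fin_num_measure//; exact: mX.
have indT C : (forall i, measurable (C i)) ->
    P [set w | forall i, C i (X i w)] = (\prod_i fine (P (X i @^-1` C i)))%:E.
  move=> mC; have := indP [set: I]%SET C (fun i _ => mC i).
  rewrite (eq_bigr (fun i => (fine (P (X i @^-1` C i)))%:E)) => [|i _];
    last exact: Pfin.
  rewrite prodEFin (eq_bigl predT) => [<-|i]; last by rewrite finset.in_setT.
  congr (P _); apply/seteqP; split=> w /= h i; first by move=> _; exact: h.
  by apply: h; rewrite finset.in_setT.
have PBE : P [set w | forall i, B i (X i w)] = (\prod_i b i)%:E by exact: indT.
(* A vanishing factor would make the whole product, the probability of the conditioning event,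
   zero. *)
have b_gt0 i : 0 < b i.
  rewrite lt0r fine_ge0 ?measure_ge0// andbT; apply/negP => /eqP b0.
  by move: PB0; rewrite PBE (bigD1 i)//= b0 mul0r ltxx.
have QJ (J : {set I}) A : (forall i, i \in J -> measurable (A i)) ->
    Q [set w | forall i, i \in J -> A i (X i w)] =
    (\prod_(i in J) (fine (P (X i @^-1` (A i `&` B i))) / b i))%:E.
  move=> mA; pose C i := if i \in J then A i `&` B i else B i.
  have mC i : measurable (C i).
    by rewrite /C; case: ifPn => // iJ; apply: measurableI => //; exact: mA.
  rewrite QE /cond_prob PBE.
  have -> : [set w | forall i, i \in J -> A i (X i w)] `&`
      [set w | forall i, B i (X i w)] =
      [set w | forall i, C i (X i w)].
    apply/seteqP; split=> w /= => [[hA hB] i|h].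
      by rewrite /C; case: ifPn => // iJ; split => //; exact: hA.
    split=> i => [iJ|]; have := h i; rewrite /C; last by case: ifP => // _ [].
    by rewrite iJ => -[].
  rewrite indT// inver gt_eqF ?prodr_gt0// -EFinM -prodf_div; congr (_%:E).
  rewrite [LHS](bigID (mem J))/= [X in _ * X]big1 ?mulr1 => [|i /negPf iJ].
    by apply: eq_bigr => i iJ; rewrite /C iJ.
  by rewrite /C iJ divff// gt_eqF//; exact: b_gt0.
(* Singletons [J] identify each factor of [QJ] as a marginal probability under [Q], which turns [QJ]
   into independence. *)
have Q1 i A : measurable A ->
    Q (X i @^-1` A) = (fine (P (X i @^-1` (A `&` B i))) / b i)%:E.
  move=> mA; have := QJ [set i]%SET (fun _ => A) (fun _ _ => mA).
  rewrite big_set1 => <-; congr (Q _); apply/seteqP; split=> w /=.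
    by move=> Aw j /set1P ->.
  by apply; rewrite inE.
split=> [J A mA|i A mA].
  rewrite QJ// -prodEFin; apply: eq_bigr => i iJ.
  by rewrite Q1//; exact: mA.
have Pb : P (X i @^-1` B i) = (b i)%:E by exact: Pfin.
split; first by rewrite Pb lte_fin.
rewrite Q1// /cond_prob Pb inver gt_eqF// -preimage_setI Pfin ?EFinM//.
exact: measurableI.
Qed.

(** The constraint on [Y j] is pulled back along [g] to one on [X (h j)]. Injectivity of [h] ensures
    that no [X i] receives two constraints and that the product reindexes. *)
Lemma mutually_independent_comp {d : measure_display} {T : measurableType d}
    {R : realType} (P : probability T R) (I J : finType)
    (X : I -> {mfun T >-> R}) (Y : J -> {mfun T >-> R}) (h : J -> I)
    (g : R -> R) :
  injective h -> measurable_fun setT g ->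
  (forall j w, Y j w = g (X (h j) w)) ->
  mutually_independent P X -> mutually_independent P Y.
Proof.
move=> hinj mg YE indX K A mA.
pose A' i := if [pick j in K | h j == i] is Some j then g @^-1` A j else setT.
have A'h j : j \in K -> A' (h j) = g @^-1` A j.
  move=> jK; rewrite /A'; case: pickP => [j' /andP[_ /eqP/hinj ->]//|/(_ j)].
  by rewrite jK eqxx.
have := indX (h @: K)%SET A'; rewrite (big_imset _ (in2W hinj))/= => indK.
transitivity (P [set w | forall i, i \in (h @: K)%SET -> A' i (X i w)]).
  congr (P _); apply/seteqP; split=> w /= hw.
    by move=> _ /imsetP[j jK ->]; rewrite A'h//= -YE; exact: hw.
  by move=> j jK; have := hw _ (imset_f h jK); rewrite A'h//= -YE.
rewrite indK => [|_ /imsetP[j jK ->]].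
  apply: eq_bigr => j jK; rewrite A'h//; congr (P _).
  by apply/seteqP; split=> w /=; rewrite YE.
by rewrite A'h// -[X in measurable X]setTI; apply: mg => //; exact: mA.
Qed.

(** A single fixed measurable map for all coordinates, so that the conditional p-values are images
    of the [p i] without reference to the random signs. *)
Definition two_sided_pval {R : realType} (x : R) : R :=
  Num.min (2 * x) (2 * (1 - x)).

Lemma measurable_two_sided_pval {R : realType} :
  measurable_fun setT (@two_sided_pval R).
Proof.
apply: measurable_minr; apply: measurable_funM => //.
exact: measurable_funB.
Qed.

HB.instance Definition _ (R : realType) :=
  isMeasurableFun.Build _ _ R R (@two_sided_pval R) measurable_two_sided_pval.

Lemma two_sided_pval_le {R : realType} (x : R) :
  x <= 2^-1 -> two_sided_pval x = 2 * x.
Proof. by move=> ?; rewrite /two_sided_pval; case: ltrP => //; lra. Qed.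

Lemma two_sided_pval_gt {R : realType} (x : R) :
  2^-1 < x -> two_sided_pval x = 2 * (1 - x).
Proof. by move=> ?; rewrite /two_sided_pval; case: ltrP => //; lra. Qed.

Lemma two_sided_pval_itv {R : realType} (x : R) :
  x \in `[0, 1] -> two_sided_pval x \in `[0, 1].
Proof.
rewrite !in_itv/= => /andP[x0 x1]; have [xle|xgt] := leP x 2^-1.
  by rewrite two_sided_pval_le//; lra.
by rewrite two_sided_pval_gt//; lra.
Qed.

Lemma cond_pvalE {d : measure_display} {T : measurableType d} {R : realType}
    {n : nat} (p : 'I_n -> {mfun T >-> R}) (w : T) (i : 'I_n) :
  cond_pval p w i = two_sided_pval (p i w).
Proof.
rewrite /cond_pval inE ffunE /qval; have [?|?] := leP (p i w) 2^-1.
  by rewrite eqxx two_sided_pval_le.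
by rewrite two_sided_pval_gt.
Qed.

Definition sign_region {R : realType} (e : int) : set R :=
  if e == -1 then [set x | x <= 2^-1] else [set x | 2^-1 < x].

Lemma measurable_sign_region {R : realType} (e : int) :
  measurable (@sign_region R e).
Proof.
rewrite /sign_region; case: ifP => _.
  by rewrite -set_itvNyc; exact: measurable_itv.
by rewrite -set_itvoy; exact: measurable_itv.
Qed.

(** Puts the sign event in the product form that [mutually_independent_cond] conditions on. *)
Lemma signs_eqE {d : measure_display} {T : measurableType d} {R : realType}
    {n : nat} (p : 'I_n -> {mfun T >-> R}) (s : {ffun 'I_n -> int}) :
  (forall i, s i = -1 \/ s i = 1) ->
  [set w | signs p w = s] = [set w | forall i, sign_region (s i) (p i w)].
Proof.
move=> hs; apply/seteqP; split=> w /= => [<- i|h].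
  by rewrite /sign_region ffunE; case: leP.
apply/ffunP => i; rewrite ffunE; have := h i; rewrite /sign_region.
by case: (hs i) => -> /=; [move=> -> | rewrite leNgt => ->].
Qed.

(** On its sign region [two_sided_pval] is the doubled one-sided p-value, and the intersection
    hypothesis gives [theta 0 i] the sign that (A1) asks for. *)
Lemma cond_two_sided_pval {d : measure_display} {T : measurableType d}
    {R : realType} {n : nat} {P : 'rV[R]_n -> probability T R}
    {p : 'I_n -> {mfun T >-> R}} {s : {ffun 'I_n -> int}}
    {I : {set 'I_n}} {theta : 'rV[R]_n} (i : 'I_n) (t : R) :
  (forall i, s i = -1 \/ s i = 1) ->
  conditionally_valid p P -> intersection_hypothesis I s theta -> i \in I ->
  0 <= t <= 1 -> (0 < P theta (p i @^-1` sign_region (s i)))%E ->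
  (cond_prob (P theta) (p i @^-1` [set x | (two_sided_pval x <= t)%R])
     (p i @^-1` sign_region (s i)) <= t%:E)%E.
Proof.
move=> hs A1 [hm hP] iI t01; have [vm vp] := A1 i t theta t01.
rewrite /sign_region; case: (hs i) => si; rewrite si /=.
  have thi : theta 0 i <= 0 by apply: hm; rewrite !inE iI si.
  move=> /(vm thi); apply: le_trans; rewrite /cond_prob.
  rewrite (_ : _ `&` _ =
    [set w | 2 * p i w <= t] `&` [set w | p i w <= 2^-1])//.
  by apply/seteqP; split=> w /= [+ h]; rewrite two_sided_pval_le.
have thi : 0 <= theta 0 i by apply: hP; rewrite !inE iI si.
move=> /(vp thi); apply: le_trans; rewrite /cond_prob.
rewrite (_ : _ `&` _ =
  [set w | 2 * qval p i w <= t] `&` [set w | 2^-1 < p i w])//.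
by apply/seteqP; split=> w /= [+ h]; rewrite two_sided_pval_gt.
Qed.

Theorem proposition3p1 (R : realType) (n : nat) (alpha : R)
  (halpha : 0 < alpha < 1)
  (d : measure_display) (T : measurableType d)
  (P : 'rV[R]_n -> probability T R)
  (p : 'I_n -> {mfun T >-> R})
  (hp : forall i w, p i w \in `[0, 1]%R)
  (A1 : conditionally_valid p P)
  (A2 : forall theta : 'rV[R]_n, mutually_independent (P theta) p)
  (f : forall m : nat, m.-tuple R -> R)
  (hf : combining_function f)
  (theta : 'rV[R]_n)
  (s : {ffun 'I_n -> int}) (hs : forall i, s i = -1 \/ s i = 1)
  (theta' : 'rV[R]_n)
  (htheta' : intersection_hypothesis (true_nulls theta s) s theta')
  (hpos : (0 < P theta' [set w | signs p w = s])%E) :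
  (cond_prob (P theta')
     [set w | local_test p f alpha (true_nulls theta (signs p w)) w]
     [set w | signs p w = s] <= alpha%:E)%E.
Proof.
set I := true_nulls theta s in htheta' *.
have Eeq := signs_eqE p s hs.
set E := [set w | signs p w = s] in hpos Eeq *.
have mE : measurable E.
  rewrite Eeq (_ : [set w | _] = \bigcap_i (p i @^-1` sign_region (s i))).
    apply: fin_bigcap_measurable => [|i _]; first exact: finite_finset.
    rewrite -[_ @^-1` _]setTI; apply: measurable_funP => //.
    exact: measurable_sign_region.
  by apply/seteqP; split=> w /= h i; [move=> _; exact: h|exact: h].
have [Q QE] := cond_prob_probability (P theta') E mE hpos.
have [] :=
  mutually_independent_cond (P theta') Q 'I_n p (fun i => sign_region (s i)).
- by move=> i; exact: measurable_sign_region.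
- exact: A2.
- by rewrite -Eeq.
- by move=> A; rewrite QE Eeq.
move=> indQ Q1.
pose Y (k : 'I_#|I|) : {mfun T >-> R} := two_sided_pval \o p (enum_val k).
(* On [E] the random index set is the fixed set [I], so the rejection event may be rewritten with
   the fixed family [Y]. *)
have -> : cond_prob (P theta')
     [set w | local_test p f alpha (true_nulls theta (signs p w)) w] E =
   Q [set w | f _ [tuple Y k w | k < #|I|] <= alpha].
  rewrite QE /cond_prob; congr (P theta' _ / _)%E.
  have YE w : [tuple Y k w | k < #|I|] =
      [tuple cond_pval p w (enum_val k) | k < #|I|].
    by apply: eq_from_tnth => k; rewrite !tnth_mktuple cond_pvalE.
  by apply/seteqP; split=> w /= [+ ws]; rewrite YE /local_test ws.
have [_ fvalid f0] := hf; case/andP: halpha => alpha0 alpha1.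
(* Validity of [f] covers positive dimensions only. With no true null, the convention that [f] is 1
   on the empty tuple and [alpha < 1] rule out rejection. *)
have [I0|I0] := posnP #|I|.
  have f1 m (x : m.-tuple R) : m = 0%N -> f m x = 1.
    by move=> m0; subst m; rewrite tuple0.
  rewrite (_ : [set w | _] = set0) ?measure0 ?lee_fin ?ltW//.
  by apply/seteqP; split=> w //=; rewrite f1// leNgt alpha1.
apply: (fvalid _ I0 _ _ Q Y) => //; last by rewrite !ltW.
- by move=> k w; exact/two_sided_pval_itv/hp.
- apply: (mutually_independent_comp _ _ _ p Y enum_val two_sided_pval) => //.
  exact: enum_val_inj.
- move=> k t t01.
  have mt : measurable [set x : R | two_sided_pval x <= t].
    rewrite (_ : [set x | _] = two_sided_pval @^-1` `]-oo, t]).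
      by rewrite -[_ @^-1` _]setTI; apply: measurable_two_sided_pval.
    by apply/seteqP; split=> x /=; rewrite in_itv.
  (* Under [Q] the marginal of each coordinate is conditioned on its own sign alone, which is the
     form of (A1). *)
  have [PB QB] := Q1 (enum_val k) _ mt.
  rewrite (_ : [set w | _] =
    p (enum_val k) @^-1` [set x | two_sided_pval x <= t])// QB.
  exact: (cond_two_sided_pval _ _ hs A1 htheta' (enum_valP k) t01 PB).
Qed.
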